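(* Let $n\ge 1$ be an integer and suppose that $B_1,\ldots,B_n$ are pairwise commuting complex $n\times n$ matrices such that $B_j$ is cyclic for some $j\in\{1,\ldots,n\}$. Then the tuple $(B_1,\ldots,B_n)$ is not hypercyclic on $\mathbb{C}^n$.
   Context: A complex $n\times n$ matrix $B$ is cyclic if there is a vector $v\in\mathbb{C}^n$ such that $v,Bv,B^2v,\ldots$ span $\mathbb{C}^n$ (equivalently, the Jordan canonical form of $B$ has exactly one Jordan block for each distinct eigenvalue). A tuple $(T_1,\ldots,T_m)$ of commuting complex $n\times n$ matrices is hypercyclic on $\mathbb{C}^n$ if there exists $x\in\mathbb{C}^n$ such that the set $\{T_1^{k_1}\cdots T_m^{k_m}x : k_1,\ldots,k_m\in\mathbb{N}\cup\{0\}\}$ is dense in $\mathbb{C}^n$. *)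

(* Defs.v *)
From HB Require Import structures.
From mathcomp Require Import all_boot all_order all_algebra.
From mathcomp Require Import complex.
From mathcomp Require Import boolp classical_sets reals topology normedtype.

Set Implicit Arguments.
Unset Strict Implicit.
Unset Printing Implicit Defensive.

Import Order.TTheory GRing.Theory Num.Theory.
Import numFieldNormedType.Exports.

Local Open Scope classical_set_scope.
Local Open Scope ring_scope.

Definition cyclic_mx (F : fieldType) (n : nat) (B : 'M[F]_n) : Prop :=
  exists v : 'cV[F]_n, forall w : 'cV[F]_n,
    exists (N : nat) (c : 'I_N -> F),
      w = \sum_(k < N) c k *: (B ^+ k *m v).

(* Intended for pairwise commuting T. The scalars are a generic numFieldType
   because the norm topology of K, hence the product topology on 'cV[K]_n, is
   inferred from that structure but not from the bare type R[i]. *)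
Definition hypercyclic (K : numFieldType) (m n : nat) (T : 'I_m -> 'M[K]_n) :
    Prop :=
  exists x : 'cV[K]_n,
    dense (range (fun k : 'I_m -> nat => (\prod_(i < m) T i ^+ k i) *m x)).

(* Main.v *)
Require Import Defs.
From HB Require Import structures.
From mathcomp Require Import all_boot all_order all_algebra.
From mathcomp Require Import complex.
From mathcomp Require Import reals.
From mathcomp Require Import ring boolp classical_sets topology normedtype.
From mathcomp Require Import sequences exp trigo.

(** Let [A] be the cyclic matrix and [q] its characteristic polynomial. All the
    [B_i] are polynomials in [A], so a dense orbit would give polynomials [g]
    and [P_1, ..., P_n] such that the classes of [g * P_1^k_1 * ... * P_n^k_n]
    are dense in [C[X]/(q)], of complex dimension [n]; discarding the [P_i]
    that vanish at some root of [q] does not affect density among the units.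

    Let [r] be the number of distinct roots of [q] and write
    [q = rad(q) * p] with [deg p = n - r]. Since [p] divides [q^`()], the class
    of [h^`() / h] modulo [p] depends only on [h] modulo [q]. The [r] numbers
    [ln |h(z)|], with [z] a root of [q], and the real parts of the [n - r]
    coordinates of [h^`() / h] form a continuous homomorphism [logvec] from the
    units of [C[X]/(q)] onto [R^n].

    If the vectors [logvec P_i] are linearly dependent, the orbit is sent into
    a proper affine subspace of [R^n]. Otherwise they form a basis, and some
    linear form [phi] on [R^n] makes the character
    [h(z_0)/|h(z_0)| * exp(i phi(logvec h))] trivial on every [P_i], hence
    constant on the orbit, whereas it separates [1] from [-1]. *)

Set Implicit Arguments.
Unset Strict Implicit.
Unset Printing Implicit Defensive.

Import Order.TTheory GRing.Theory Num.Theory.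
Import numFieldNormedType.Exports.

Local Open Scope classical_set_scope.
Local Open Scope ring_scope.
Local Open Scope complex_scope.

(** * Polynomials modulo [p] and logarithmic derivatives *)

Section ModularCoordinates.
Variables (F : fieldType) (d : nat) (p : {poly F}).
Hypothesis size_p : size p = d.+1.
Implicit Types f g h : {poly F}.

Definition modp_rV f : 'rV[F]_d := poly_rV (f %% p).

(** Multiplication by [h] on [F[X]/(p)] in the monomial basis, acting on row vectors from the
    right. *)
Definition modp_mul_mx h : 'M[F]_d := \matrix_i modp_rV ('X^i * h).

(** Coordinates of the class of f'/f modulo [p], meaningful for [f] coprime to [p], where the matrix
    is invertible. *)
Definition logder f : 'rV[F]_d := modp_rV f^`() *m invmx (modp_mul_mx f).

Lemma modp_rV_is_linear : linear modp_rV.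
Proof. by move=> a f g; rewrite /modp_rV modpD modpZl linearP. Qed.

HB.instance Definition _ :=
  GRing.isLinear.Build F {poly F} 'rV[F]_d _ modp_rV modp_rV_is_linear.

Lemma modp_rV_eq f g : p %| f - g -> modp_rV f = modp_rV g.
Proof.
move=> /modp_eq0P pfg; apply/eqP.
by rewrite -subr_eq0 -linearB /= /modp_rV pfg linear0.
Qed.

Let p_neq0 : p != 0. Proof. by rewrite -size_poly_eq0 size_p. Qed.

Lemma size_modp_le f : (size (f %% p)%R <= d)%N.
Proof. by rewrite -ltnS -size_p ltn_modp. Qed.

Lemma modp_rV_mul f h : modp_rV f *m modp_mul_mx h = modp_rV (f * h).
Proof.
have -> : modp_rV (f * h) = modp_rV ((f %% p) * h).
  by rewrite /modp_rV mulrC -modp_mul mulrC.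
rewrite -[f %% p in RHS](poly_rV_K (size_modp_le f)) -/(modp_rV f).
rewrite mulmx_sum_row /rVpoly poly_def mulr_suml linear_sum.
apply: eq_bigr => i _; rewrite rowK insubT //= => lt_i_d.
rewrite -scalerAl linearZ /=.
by congr (modp_rV f _ _ *: _); apply: val_inj.
Qed.

Lemma modp_mul_mxM f h :
  modp_mul_mx (f * h) = modp_mul_mx f *m modp_mul_mx h.
Proof. by apply/row_matrixP => i; rewrite row_mul !rowK modp_rV_mul mulrA. Qed.

Lemma modp_mul_mx1 : modp_mul_mx 1 = 1%:M.
Proof.
apply/row_matrixP => i; rewrite rowK mulr1 row1 /modp_rV modp_small.
  by apply/rowP => j; rewrite !mxE eqxx coefXn.
by rewrite size_polyXn size_p ltnS.
Qed.

(** A Bezout cofactor of [h] modulo [p] provides the inverse. *)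
Lemma modp_mul_mx_unit h : coprimep h p -> modp_mul_mx h \in unitmx.
Proof.
move=> /Bezout_eq1_coprimepP [[u v] /= uv1].
suff /mulmx1_unit [] : modp_mul_mx u *m modp_mul_mx h = 1%:M by [].
rewrite -modp_mul_mxM -modp_mul_mx1; apply/row_matrixP => i; rewrite !rowK.
apply: modp_rV_eq; rewrite -mulrBr -uv1 opprD addNKr.
by rewrite dvdp_mull // dvdpNr dvdp_mull.
Qed.

Lemma logder_eq h (y : 'rV_d) : coprimep h p ->
  y *m modp_mul_mx h = modp_rV h^`() -> logder h = y.
Proof. by move=> hp e; rewrite /logder -e mulmxK // modp_mul_mx_unit. Qed.

Lemma logder_mul_mx h : coprimep h p ->
  logder h *m modp_mul_mx h = modp_rV h^`().
Proof. by move=> hp; rewrite /logder mulmxKV // modp_mul_mx_unit. Qed.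

(** By [logder_eq] this is the Leibniz rule read modulo [p]. *)
Lemma logderM f h : coprimep f p -> coprimep h p ->
  logder (f * h) = logder f + logder h.
Proof.
move=> fp hp; apply: logder_eq; first by rewrite coprimepMl fp.
rewrite mulmxDl modp_mul_mxM mulmxA logder_mul_mx // -modp_mul_mxM mulrC.
rewrite modp_mul_mxM mulmxA logder_mul_mx // !modp_rV_mul -linearD /=.
by rewrite [h * f]mulrC derivM [f * h^`()]mulrC.
Qed.

Lemma logder_poly h (y : 'rV_d) : coprimep h p ->
  p %| h^`() - rVpoly y * h -> logder h = y.
Proof.
move=> hp py; apply: logder_eq => //; rewrite (modp_rV_eq py) -modp_rV_mul.
rewrite /modp_rV modp_small ?rVpolyK // size_p ltnS.
by rewrite (leq_trans (size_poly _ _)).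
Qed.

End ModularCoordinates.

Lemma modp_sumXn (F : fieldType) n (f q : {poly F}) :
  q != 0 -> (size q <= n.+1)%N -> f %% q = \sum_(i < n) (f %% q)`_i *: 'X^i.
Proof.
move=> q0 size_q; rewrite -poly_def; apply/polyP => i; rewrite coef_poly.
case: ltnP => // le_n_i; rewrite nth_default // (leq_trans _ le_n_i) //.
by rewrite -ltnS (leq_trans _ size_q) // ltn_modp.
Qed.

(** * Products of linear factors and interpolation at their roots *)

Section Roots.
Variable F : fieldType.
Implicit Types (p q f : {poly F}) (rs : seq F).

Definition rootprod rs : {poly F} := \prod_(z <- rs) ('X - z%:P).

Lemma rootprod_cons z rs : rootprod (z :: rs) = ('X - z%:P) * rootprod rs.
Proof. by rewrite /rootprod big_cons. Qed.

Lemma dvdp_deriv_exp p f n : p ^+ n.+1 %| f -> p ^+ n %| f^`().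
Proof.
case/dvdpP=> g ->; rewrite derivM deriv_exp /= dvdp_add //.
  by rewrite dvdp_mull // exprS dvdp_mull.
by rewrite dvdp_mull // -mulrnAl dvdp_mull.
Qed.

Lemma rootprod_dvd_exp rs :
  rootprod rs %| rootprod (undup rs) ^+ size rs.
Proof.
(* The induction runs over lists [s] drawn from [rs], which keeps the radical fixed. *)
suff: forall s, {subset s <= rs} -> rootprod s %| rootprod (undup rs) ^+ size s.
  by apply.
elim=> [|z s IHs] sub_rs; first by rewrite /rootprod big_nil dvd1p.
rewrite rootprod_cons exprS dvdp_mul //.
  by rewrite dvdp_XsubCl root_prod_XsubC mem_undup sub_rs ?mem_head.
by apply: IHs => x xs; rewrite sub_rs // inE xs orbT.
Qed.

(** Adding a repeated root multiplies the cofactor [p] by its linear factor; adding a new root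
    enlarges only the radical. *)
Lemma rootprod_undup rs : exists p : {poly F}, [/\ p \is monic,
  rootprod rs = rootprod (undup rs) * p & p %| (rootprod rs)^`()].
Proof.
elim: rs => [|z rs [p [p_mon rsE dvd_p]]].
  by exists 1; rewrite monic1 mulr1 dvd1p.
rewrite rootprod_cons derivM derivXsubC mul1r rsE /=.
have [zrs|zrs] := boolP (z \in rs).
  exists (('X - z%:P) * p); split; first by rewrite rpredM ?monicXsubC.
    by rewrite mulrCA.
  rewrite -rsE dvdp_add ?dvdp_mul // rsE dvdp_mul //.
  by rewrite dvdp_XsubCl root_prod_XsubC mem_undup.
exists p; split => //; first by rewrite rootprod_cons mulrA.
by rewrite -rsE dvdp_add ?dvdp_mull // rsE dvdp_mull.
Qed.

Lemma coprimep_rootprod f rs :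
  (forall z, z \in rs -> f.[z] != 0) -> coprimep f (rootprod rs).
Proof.
elim: rs => [|z rs IHrs] fz; first by rewrite /rootprod big_nil coprimep1.
rewrite rootprod_cons coprimepMr coprimep_XsubC fz ?mem_head //.
by apply: IHrs => x xs; rewrite fz // inE xs orbT.
Qed.

(** Chinese remainder theorem: [f] is built congruent to the constant [a z] modulo each
    [('X - z%:P) ^+ n.+1], so its derivative vanishes to order [n] there. *)
Lemma locally_constant_interp n rs (a : F -> F) : uniq rs ->
  exists2 f, forall z, z \in rs -> f.[z] = a z & rootprod rs ^+ n %| f^`().
Proof.
elim: rs => [|z rs IHrs] /=; first by exists 0; rewrite ?deriv0 ?dvdp0.
case/andP=> zrs /IHrs[f fa df].
have co m : coprimep (('X - z%:P) ^+ m) (rootprod rs ^+ m).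
  apply/coprimep_expl/coprimep_expr; rewrite coprimep_sym coprimep_XsubC.
  by rewrite root_prod_XsubC.
have /Bezout_eq1_coprimepP[[u v] /= uv1] := co n.+1.
(* [e] is 1 modulo [('X - z%:P) ^+ n.+1] and 0 modulo [rootprod rs ^+ n.+1]. *)
set e := v * _ in uv1.
have eE : 1 - e = u * ('X - z%:P) ^+ n.+1 by rewrite -uv1 addrK.
exists (f * (1 - e) + (a z)%:P * e).
  have hE x : (f * (1 - e) + (a z)%:P * e).[x]
              = f.[x] * (1 - e.[x]) + a z * e.[x].
    by rewrite !(hornerD, hornerM, hornerN) !hornerC.
  move=> x; rewrite hE inE => /predU1P[->|xrs].
    have -> : e.[z] = 1.
      apply/eqP; rewrite eq_sym -subr_eq0 -[X in X - _](hornerC 1 z) -hornerN.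
      by rewrite -hornerD polyC1 eE !hornerE subrr exprS mul0r mulr0.
    by rewrite subrr mulr0 add0r mulr1.
  have -> : e.[x] = 0.
    have /eqP r0 : root (rootprod rs) x by rewrite root_prod_XsubC.
    by rewrite /e hornerM horner_exp r0 exprS mul0r mulr0.
  by rewrite subr0 mulr1 mulr0 addr0 fa.
have -> : (f * (1 - e) + (a z)%:P * e)^`()
          = f^`() * (1 - e) + ((a z)%:P - f) * e^`().
  by rewrite !derivE; ring.
rewrite rootprod_cons exprMn Gauss_dvdp ?co //; apply/andP; split.
  rewrite dvdp_add //; first by rewrite eE !dvdp_mull // exprS dvdp_mull.
  have -> : e^`() = - (1 - e)^`() by rewrite derivB derivC sub0r opprK.
  by rewrite dvdp_mull // dvdpNr dvdp_deriv_exp // eE dvdp_mull.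
have dve : rootprod rs ^+ n %| e^`() by apply: dvdp_deriv_exp; apply: dvdp_mull.
by rewrite dvdp_add // ?(dvdp_mulr _ df) ?(dvdp_mull _ dve).
Qed.
End Roots.

(** * Prescribing values and logarithmic derivative simultaneously *)

Section Surjectivity.
Variable F : numFieldType.
Implicit Types (f u : {poly F}) (rs : seq F).

(** The constant term is a division by zero, which yields 0. *)
Definition antideriv f : {poly F} := \poly_(i < (size f).+1) (f`_i.-1 / i%:R).

Lemma antiderivK f : (antideriv f)^`() = f.
Proof.
apply/polyP => i; rewrite coef_deriv coef_poly ltnS /=.
case: ltnP => [_|szf]; last by rewrite mul0rn nth_default.
by rewrite -[LHS]mulr_natr divfK // pnatr_eq0.
Qed.

Definition expp n u : {poly F} := \sum_(k < n) (k`!%:R)^-1 *: u ^+ k.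

Lemma deriv_expp n u : (expp n.+1 u)^`() = u^`() * expp n u.
Proof.
rewrite /expp raddf_sum big_ord_recl /= expr0 derivZ derivC scaler0 add0r.
rewrite mulr_sumr; apply: eq_bigr => i _ /=.
rewrite /bump /= add1n derivZ deriv_exp /= -scalerMnr scalerMnl -scalerAr.
congr (_ *: _); rewrite -[LHS]mulr_natr factS natrM invfM mulrAC.
by rewrite mulVf ?mul1r // pnatr_eq0.
Qed.

(* If [u] vanishes on [rs], then [expp n u] is an exponential of [u] modulo
   [rootprod rs ^+ n]; take [h] to be this exponential, with [u^`()] congruent
   to [f], times a polynomial with the prescribed values whose derivative is
   divisible by [rootprod rs ^+ n]. *)
Lemma logderiv_interp n rs (a : F -> F) f : uniq rs ->
  exists2 h, forall z, z \in rs -> h.[z] = a z &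
             rootprod rs ^+ n %| h^`() - f * h.
Proof.
move=> rs_uniq; have [h ha dh] := locally_constant_interp n a rs_uniq.
(* Subtracting [g] makes [u] vanish on [rs] without changing its derivative modulo
   [rootprod rs ^+ n]. *)
have [g gF dg] :=
  locally_constant_interp n (fun z => (antideriv f).[z]) rs_uniq.
pose u := antideriv f - g.
have uz z : z \in rs -> u.[z] = 0 by move=> zrs; rewrite !hornerE gF ?subrr.
have rad_u : rootprod rs %| u.
  have [||v ->] := @uniq_roots_prod_XsubC _ u rs; rewrite ?dvdp_mull //.
    by apply/allP => z /uz /eqP.
  by rewrite uniq_rootsE.
have du : u^`() = f - g^`() by rewrite derivB antiderivK.
exists (h * expp n.+1 u).
  move=> z zrs; rewrite hornerM ha // /expp big_ord_recl /= hornerD.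
  rewrite horner_sum big1 => [|i _]; last first.
    by rewrite hornerZ horner_exp uz // exprS mul0r mulr0.
  by rewrite fact0 expr0 invr1 scale1r addr0 -polyC1 hornerC mulr1.
(* Differentiating [expp n.+1 u] loses the last term; that term is divisible by [rootprod rs ^+ n]
   because [rootprod rs] divides [u]. *)
have -> : expp n.+1 u = expp n u + (n`!%:R)^-1 *: u ^+ n.
  by rewrite /expp big_ord_recr.
rewrite derivM.
have -> : (expp n u + (n`!%:R)^-1 *: u ^+ n)^`() = (f - g^`()) * expp n u.
  by rewrite -du -deriv_expp /expp big_ord_recr.
set E := expp n u; set w := _ *: _.
have -> : h^`() * (E + w) + h * ((f - g^`()) * E) - f * (h * (E + w))
   = h^`() * (E + w) - (h * E) * g^`() - (f * h) * w.
  by ring.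
have w_dvd : rootprod rs ^+ n %| w.
  by rewrite dvdpZr ?dvdp_exp2r // invr_eq0 pnatr_eq0 -lt0n fact_gt0.
by rewrite !dvdp_add ?dvdpNr ?(dvdp_mulr _ dh) ?(dvdp_mull _ dg) ?dvdp_mull.
Qed.
End Surjectivity.

(** * Limits of matrix entries and of complex functions *)

Section CvgMatrix.
Variables (K : numFieldType) (J : Type) (F : set_system J).
Context {FF : Filter F}.

Lemma cvg_bigsum (I : Type) (r : seq I) (P : pred I) (f : I -> J -> K)
    (a : I -> K) : (forall i, f i x @[x --> F] --> a i) ->
  \sum_(i <- r | P i) f i x @[x --> F] --> \sum_(i <- r | P i) a i.
Proof.
move=> fa; elim: r => [|i r IHr].
  by under eq_fun do rewrite big_nil; rewrite big_nil; exact: cvg_cst.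
under eq_fun do rewrite big_cons; rewrite big_cons.
by case: (P i) => //; apply: cvgD.
Qed.

Lemma cvg_bigprod (I : Type) (r : seq I) (P : pred I) (f : I -> J -> K)
    (a : I -> K) : (forall i, f i x @[x --> F] --> a i) ->
  \prod_(i <- r | P i) f i x @[x --> F] --> \prod_(i <- r | P i) a i.
Proof.
move=> fa; elim: r => [|i r IHr].
  by under eq_fun do rewrite big_nil; rewrite big_nil; exact: cvg_cst.
under eq_fun do rewrite big_cons; rewrite big_cons.
by case: (P i) => //; apply: cvgM.
Qed.

Lemma cvg_det n (G : J -> 'M[K]_n) (A : 'M[K]_n) :
  (forall i j, G x i j @[x --> F] --> A i j) ->
  \det (G x) @[x --> F] --> \det A.
Proof.
move=> GA; apply: cvg_bigsum => s; apply: cvgM; first exact: cvg_cst.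
by apply: cvg_bigprod.
Qed.

(** Cramer's rule, which applies eventually along [F] because the determinants tend to a nonzero
    limit. *)
Lemma cvg_invmx n (G : J -> 'M[K]_n) (A : 'M[K]_n) : A \in unitmx ->
  (forall i j, G x i j @[x --> F] --> A i j) ->
  forall i j, invmx (G x) i j @[x --> F] --> invmx A i j.
Proof.
move=> uA GA i j; have detA := cvg_det GA.
have detA0 : \det A != 0 by rewrite -unitfE -unitmxE.
have invA (B : 'M[K]_n) : \det B != 0 ->
    invmx B i j = (\det B)^-1 * ((-1) ^+ (j + i) * \det (row' j (col' i B))).
  by move=> B0; rewrite /invmx unitmxE unitfE B0 !mxE.
have minorA : \det (row' j (col' i (G x))) @[x --> F]
    --> \det (row' j (col' i A)).
  apply: cvg_det => k l; rewrite !mxE.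
  by under eq_fun do rewrite !mxE; exact: GA.
rewrite invA //.
pose cramer x :=
  (\det (G x))^-1 * ((-1) ^+ (j + i) * \det (row' j (col' i (G x)))).
apply: (@cvg_trans _ (cramer x @[x --> F])); last first.
  apply: cvgM; first exact: cvgV.
  by apply: cvgM; first exact: cvg_cst.
apply: near_eq_cvg; near=> x; rewrite invA //=.
by near: x; apply: cvgr_neq0 detA _.
Unshelve. all: by end_near. Qed.
End CvgMatrix.

Section ComplexCvg.
Variables (R : realType) (J : Type) (F : set_system J).
Context {FF : Filter F}.
Local Notation C := (R[i] : numFieldType).
Implicit Types (f : J -> C) (z : C).

Lemma cvg_Re f z : f x @[x --> F] --> z ->
  complex.Re (f x) @[x --> F] --> complex.Re z.
Proof.
move=> fz; apply/cvgrPdist_lt => e e0.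
have /cvgrPdist_lt/(_ e%:C) := fz; rewrite ltcR => /(_ e0).
apply: filterS => x; rewrite -ltcR; apply: le_lt_trans.
by rewrite -raddfB; exact: normc_ge_Re.
Qed.

Lemma Im_Re z : complex.Im z = complex.Re (- 'i%C * z).
Proof. by case: z => a b; rewrite /=; ring. Qed.

Lemma cvg_Im f z : f x @[x --> F] --> z ->
  complex.Im (f x) @[x --> F] --> complex.Im z.
Proof.
move=> fz; rewrite Im_Re.
rewrite (_ : (fun x => _) = fun x => complex.Re (- 'i%C * f x)); last first.
  by apply/funext => x; rewrite Im_Re.
apply: cvg_Re; apply: cvgM; last exact: fz.
exact: cvg_cst.
Qed.

(** The norm of [R[i]] takes its values in [R[i]]; [ln] requires the modulus as an element of
    [R]. *)
Definition cabs z : R := complex.Re `|z|.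

Lemma cvg_cabs f z : f x @[x --> F] --> z -> cabs (f x) @[x --> F] --> cabs z.
Proof. by move=> fz; apply: cvg_Re; apply: cvg_norm. Qed.

Lemma cabsE z : (cabs z)%:C = `|z|.
Proof. by rewrite /cabs RRe_real // normr_real. Qed.

Lemma cabsM : {morph cabs : z w / z * w}.
Proof. by move=> z w; apply: complexI; rewrite rmorphM /= !cabsE normrM. Qed.

Lemma cabs_gt0 z : (0 < cabs z) = (z != 0).
Proof. by rewrite -ltcR cabsE normr_gt0. Qed.

Lemma polar z : exists t : R,
  z = (cabs z * cos t +i* (cabs z * sin t))%C.
Proof.
have [->|z0] := eqVneq z 0.
  by exists 0; rewrite /cabs normr0 /= !mul0r.
have := cabs_gt0 z; rewrite z0; set r := cabs z => r0.
have r2 : complex.Re z ^+ 2 + complex.Im z ^+ 2 = r ^+ 2.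
  rewrite /r /cabs normc_def /= sqr_sqrtr //.
  by rewrite addr_ge0 // sqr_ge0.
pose x := complex.Re z / r; pose y := complex.Im z / r.
have xy : x ^+ 2 + y ^+ 2 = 1.
  by rewrite !expr_div_n -mulrDl r2 divff // sqrf_eq0 gt_eqF.
have x1 : -1 <= x <= 1.
  rewrite -ler_norml -(@expr_le1 _ 2) // real_normK ?num_real //.
  by rewrite -xy lerDl sqr_ge0.
have siny : sin (acos x) = `|y|.
  by rewrite sin_acos // -xy addrAC subrr add0r sqrtr_sqr.
have cosx : cos (acos x) = x by rewrite acosK // in_itv.
have zE : z = (r * x +i* (r * y))%C.
  rewrite /x /y !(mulrC r) !divfK ?gt_eqF //; by case: (z).
(* [acos] only yields angles with nonnegative sine, so the sign of [y] selects the half-plane. *)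
exists (if 0 <= y then acos x else - acos x); rewrite {1}zE.
case: ifPn => [y0|]; first by rewrite cosx siny ger0_norm.
by rewrite -ltNge => y0; rewrite cosN sinN cosx siny ltr0_norm // opprK.
Qed.
End ComplexCvg.

(** * Logarithmic coordinates *)

Section CvgPoly.
Variables (K : numFieldType) (J : Type) (F : set_system J).
Context {FF : Filter F}.

(** A linear form that factors through [K[X]/(q)] is a fixed finite combination of the coefficients
    of the remainder, hence continuous in them. *)
Lemma cvg_modp_scalar (q : {poly K}) (H : J -> {poly K}) (h : {poly K})
    (l : {poly K} -> K) : q != 0 -> scalar l -> (forall f, q %| f -> l f = 0) ->
  (forall i, ((H x) %% q)`_i @[x --> F] --> (h %% q)`_i) ->
  l (H x) @[x --> F] --> l h.
Proof.
move=> q0 l_lin lq Hh.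
pose L : {scalar {poly K}} :=
  HB.pack l (GRing.isLinear.Build K {poly K} K *%R l l_lin).
have lE f : l f = \sum_(i < size q) (f %% q)`_i * l 'X^i.
  have lL : l =1 L by [].
  rewrite {1}(divp_eq f q) lL linearD -!lL lq ?dvdp_mull // add0r.
  rewrite {1}(modp_sumXn f q0 (leqnSn _)).
  by rewrite lL linear_sum; apply: eq_bigr => i _; rewrite linearZ.
rewrite lE; under eq_fun do rewrite lE.
apply: cvg_bigsum => i; apply: cvgM; [exact: Hh | exact: cvg_cst].
Qed.
End CvgPoly.

Lemma ReD (R : rcfType) (z w : R[i]) :
  complex.Re (z + w) = complex.Re z + complex.Re w.
Proof. by case: z w => [? ?] [? ?]. Qed.

Section LogCoordinates.
Variable R : realType.
Local Notation C := (R[i] : numFieldType).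
Variables (rs : seq C) (d : nat) (p q : {poly C}) (N : nat).
Hypothesis rs_uniq : uniq rs.
Hypothesis size_p : size p = d.+1.
Hypothesis p_dvd_rad : p %| rootprod rs ^+ N.
Hypothesis q_neq0 : q != 0.
Hypothesis p_dvd_q : p %| q.
Hypothesis p_dvd_dq : p %| q^`().
Hypothesis rs_root : all (root q) rs.
Implicit Types f g h : {poly C}.

(** When [rs] lists all roots of [q], these polynomials represent the units of [C[X]/(q)]. *)
Definition nonvanishing h := all (fun z => h.[z] != 0) rs.

Definition logvec h : 'rV[R]_(size rs + d) :=
  row_mx (\row_s ln (cabs h.[rs`_s])) (map_mx (@complex.Re R) (logder d p h)).

Lemma nonvanishing_coprimep h : nonvanishing h -> coprimep h p.
Proof.
move=> /allP hz; apply: coprimep_dvdl p_dvd_rad _.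
by apply: coprimep_expr; apply: coprimep_rootprod.
Qed.

Lemma nonvanishingM f h :
  nonvanishing (f * h) = nonvanishing f && nonvanishing h.
Proof.
rewrite /nonvanishing -all_predI; apply: eq_all => z /=.
by rewrite hornerM mulf_eq0 negb_or.
Qed.

Lemma nonvanishing1 : nonvanishing 1.
Proof. by apply/allP => z _; rewrite hornerC oner_neq0. Qed.

Lemma logvecM f h : nonvanishing f -> nonvanishing h ->
  logvec (f * h) = logvec f + logvec h.
Proof.
move=> fz hz; rewrite /logvec add_row_mx; congr row_mx.
  apply/rowP => s; rewrite !mxE hornerM cabsM lnM // posrE cabs_gt0.
    by apply: (allP fz); rewrite mem_nth.
  by apply: (allP hz); rewrite mem_nth.
rewrite (logderM size_p); [|exact: nonvanishing_coprimep..].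
apply/rowP => j; rewrite [LHS]mxE [RHS]mxE [X in _ = X + _]mxE.
rewrite [X in _ = _ + X]mxE [X in complex.Re X]mxE.
exact: ReD.
Qed.

Lemma logvec1 : logvec 1 = 0.
Proof.
by apply: (addrI (logvec 1)); rewrite -logvecM ?nonvanishing1 // mulr1 addr0.
Qed.

Lemma logvecX f k : nonvanishing f ->
  nonvanishing (f ^+ k) /\ logvec (f ^+ k) = logvec f *+ k.
Proof.
move=> fz; elim: k => [|k [fkz IHk]]; first by rewrite nonvanishing1 logvec1.
by rewrite exprS nonvanishingM fz logvecM // IHk mulrS.
Qed.

Lemma logvec_prod (I : Type) (r : seq I) (P : I -> {poly C}) (k : I -> nat) :
  (forall i, nonvanishing (P i)) ->
  nonvanishing (\prod_(i <- r) P i ^+ k i) /\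
  logvec (\prod_(i <- r) P i ^+ k i) = \sum_(i <- r) logvec (P i) *+ k i.
Proof.
move=> Pz; elim: r => [|i r [rz IHr]].
  by rewrite !big_nil nonvanishing1 logvec1.
have [iz Ei] := logvecX (k i) (Pz i).
by rewrite !big_cons nonvanishingM iz logvecM // IHr Ei.
Qed.

(** [logderiv_interp] is applied with positive real values, the exponentials of the left block of
    [y], and with the right block as logarithmic derivative. *)
Lemma logvec_surj (y : 'rV[R]_(size rs + d)) :
  exists2 h, nonvanishing h & logvec h = y.
Proof.
pose b := [seq y 0 (lshift d s) | s : 'I_(size rs)].
pose a (z : C) : C := (expR b`_(index z rs))%:C.
pose f : {poly C} := rVpoly (map_mx (fun x : R => x%:C : C) (rsubmx y)).
have [h ha dh] := logderiv_interp N a f rs_uniq.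
have hz : nonvanishing h.
  apply/allP => z zrs; rewrite ha // -cabs_gt0 /cabs.
  by rewrite ger0_norm ?lecR ?expR_ge0 //= expR_gt0.
exists h => //; rewrite -[y]hsubmxK /logvec; congr row_mx.
  apply/rowP => s; rewrite !mxE ha ?mem_nth // /a index_uniq //.
  rewrite /cabs ger0_norm ?lecR ?expR_ge0 //= expRK.
  by rewrite (nth_map s) ?size_enum_ord // nth_ord_enum.
rewrite (logder_poly size_p (nonvanishing_coprimep hz)
  (dvdp_trans p_dvd_rad dh)).
by apply/rowP => j; rewrite !mxE.
Qed.

(** Makes differentiation a well-defined map from [C[X]/(q)] to [C[X]/(p)]. *)
Lemma modp_rV_deriv_eq0 f : q %| f -> modp_rV d p f^`() = 0.
Proof.
case/dvdpP=> g ->; rewrite -(linear0 (modp_rV d p)); apply: modp_rV_eq.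
by rewrite subr0 derivM dvdp_add // dvdp_mull.
Qed.

Section Cvg.
Variables (J : Type) (F : set_system J).
Context {FF : Filter F}.
Variables (H : J -> {poly C}) (h : {poly C}).
Hypothesis Hh : forall i, ((H x) %% q)`_i @[x --> F] --> (h %% q)`_i.

Lemma cvg_horner z : z \in rs -> (H x).[z] @[x --> F] --> h.[z].
Proof.
move=> zrs; apply: (cvg_modp_scalar (l := fun f => f.[z]) q_neq0) Hh.
  by move=> a f g; rewrite !hornerE.
move=> f /dvdpP[g ->]; rewrite hornerM.
by move/eqP: (allP rs_root z zrs) => ->; rewrite mulr0.
Qed.

(** The values at the roots, the derivative modulo [p] and the multiplication matrix are all linear
    in the class modulo [q]; [ln] and [invmx] are continuous at the limits. *)
Lemma cvg_logvec j : nonvanishing h ->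
  logvec (H x) 0 j @[x --> F] --> logvec h 0 j.
Proof.
move=> hz; rewrite -(splitK j); case: (fintype.split j) => s /=.
  under eq_fun do rewrite row_mxEl mxE; rewrite row_mxEl mxE.
  have zrs : rs`_s \in rs by rewrite mem_nth.
  apply: (@continuous_cvg _ _ _ _ _ (fun x => cabs (H x).[rs`_s])).
    by apply: continuous_ln; rewrite cabs_gt0 (allP hz).
  by apply: cvg_cabs; apply: cvg_horner.
under eq_fun do rewrite row_mxEr mxE; rewrite row_mxEr mxE.
apply: cvg_Re; rewrite mxE; under eq_fun do rewrite mxE.
apply: cvg_bigsum => i; apply: cvgM.
  apply: (cvg_modp_scalar (l := fun f => modp_rV d p f^`() 0 i) q_neq0) Hh.
    by move=> a f g; rewrite derivD derivZ linearP !mxE.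
  by move=> f /modp_rV_deriv_eq0 ->; rewrite mxE.
apply: cvg_invmx.
  by rewrite (modp_mul_mx_unit size_p) ?nonvanishing_coprimep.
move=> k l; rewrite mxE; under eq_fun do rewrite mxE.
apply: (cvg_modp_scalar (l := fun f => modp_rV d p ('X^k * f) 0 l) q_neq0) Hh.
  by move=> a f g; rewrite mulrDr -scalerAr linearP !mxE.
move=> f qf; have -> : modp_rV d p ('X^k * f) = 0; last by rewrite mxE.
rewrite -(linear0 (modp_rV d p)); apply: modp_rV_eq.
by rewrite subr0 dvdp_mull // (dvdp_trans p_dvd_q).
Qed.
End Cvg.

Lemma near_nonvanishing (J : Type) (F : set_system J) (FF : Filter F)
    (H : J -> {poly C}) h :
  (forall i, ((H x) %% q)`_i @[x --> F] --> (h %% q)`_i) ->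
  nonvanishing h -> \forall x \near F, nonvanishing (H x).
Proof.
move=> Hh; have := fun z => @cvg_horner J F FF H h Hh z.
rewrite /nonvanishing; elim: (rs) => [|z s IHs] Hs /=.
  by move=> _; apply: filterE.
case/andP=> hz hs.
apply: filterS2 (cvgr_neq0 _ (Hs z (mem_head z s)) hz) (IHs _ hs).
  by move=> x /= -> ->.
by move=> y ys; apply: Hs; rewrite inE ys orbT.
Qed.

End LogCoordinates.

(** * Subgroups of R^m x C^* generated by m elements *)

Section Lattice.
Variable R : realType.
Local Notation C := (R[i] : numFieldType).

(** A relation rather than a chosen argument, so that arguments add exactly, with no reduction
    modulo 2 pi. *)
Definition has_arg (z : C) (t : R) :=
  z = (cabs z * cos t +i* (cabs z * sin t))%C.

Lemma has_argM (z w : C) s t :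
  has_arg z s -> has_arg w t -> has_arg (z * w) (s + t).
Proof.
rewrite /has_arg => zs wt; rewrite cabsM cosD sinD {1}zs {1}wt.
by apply/eqP; rewrite eq_complex /=; apply/andP; split; apply/eqP; ring.
Qed.

Lemma has_arg1 : has_arg 1 0.
Proof. by rewrite /has_arg cos0 sin0 /cabs normr1 /= mulr1 mulr0. Qed.

Lemma has_argX (z : C) t k : has_arg z t -> has_arg (z ^+ k) (t *+ k).
Proof.
move=> zt; elim: k => [|k IHk]; last by rewrite exprS mulrS; exact: has_argM.
exact: has_arg1.
Qed.

Lemma has_arg_prod (I : Type) (r : seq I) (z : I -> C) (t : I -> R)
    (k : I -> nat) : (forall i, has_arg (z i) (t i)) ->
  has_arg (\prod_(i <- r) z i ^+ k i) (\sum_(i <- r) t i *+ k i).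
Proof.
move=> zt; elim: r => [|i r IHr]; first by rewrite !big_nil; exact: has_arg1.
by rewrite !big_cons; apply: has_argM => //; exact: has_argX.
Qed.

(** The first density hypothesis refutes a singular [M]; the second, taken at 1 and -1, refutes an
    invertible one. *)
Lemma coset_not_dense m (M : 'M[R]_m) (a : 'rV[R]_m) (b : C) (w : 'I_m -> C) :
  let y (k : 'I_m -> nat) : 'rV[R]_m := a + (\row_i (k i)%:R) *m M in
  let z (k : 'I_m -> nat) : C := b * \prod_i w i ^+ k i in
  (forall y0 : 'rV[R]_m, exists F : set_system ('I_m -> nat), ProperFilter F /\
     forall j, y k 0 j @[k --> F] --> y0 0 j) ->
  (forall z0 : C, `|z0| = 1 -> exists F : set_system ('I_m -> nat),
     [/\ ProperFilter F, forall j, y k 0 j @[k --> F] --> (0 : R) &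
         z k @[k --> F] --> z0]) -> False.
Proof.
move=> y z ydense zdense.
have cvg_lin (c : 'cV[R]_m) (y0 : 'rV[R]_m) (F : set_system ('I_m -> nat)) :
    ProperFilter F -> (forall j, y k 0 j @[k --> F] --> y0 0 j) ->
    (y k *m c) 0 0 @[k --> F] --> (y0 *m c) 0 0.
  move=> FF yy0; rewrite mxE; under eq_fun do rewrite mxE.
  by apply: cvg_bigsum => i; apply: cvgM; [exact: yy0 | exact: cvg_cst].
have [Mu|Mnu] := boolP (M \in unitmx); last first.
  (* A nonzero [v] with [M *m v^T = 0] makes [y k *m v^T] constant, yet [y] approaches
     [a + delta_mx 0 j], where this linear form takes another value. *)
  have /det0P[v v0 vM] : \det M^T == 0.
    by rewrite det_tr; apply: contraNT Mnu; rewrite unitmxE unitfE.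
  have Mv : M *m v^T = 0 by rewrite -[M]trmxK -trmx_mul vM trmx0.
  have [j vj] : exists j, v 0 j != 0 by apply/rV0Pn.
  have [F [FF yF]] := ydense (a + delta_mx 0 j).
  have lim1 := cvg_lin v^T _ F FF yF.
  have lim2 : (y k *m v^T) 0 0 @[k --> F] --> (a *m v^T) 0 0.
    under eq_fun do rewrite mulmxDl -mulmxA Mv mulmx0 addr0; exact: cvg_cst.
  suff: (a + delta_mx 0 j) *m v^T != a *m v^T :> 'M_1.
    move/eqP; apply; apply/matrixP => i k; rewrite !ord1.
    exact: norm_cvg_unique lim1 lim2.
  apply/eqP => /(congr1 (fun A : 'M_1 => A 0 0)) /eqP; apply/negP.
  rewrite mulmxDl -rowE [X in X != _]mxE [X in _ + X != _]mxE.
  by rewrite [X in _ + X != _]mxE -subr_eq0 addrAC subrr add0r.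
have [t0 bt0] := polar b.
have /choice[t wt] i := polar (w i).
(* This linear form cancels the argument of each generator: raising [k i] by one adds [t i] to the
   argument of [z k] and subtracts it from [y k *m c]. *)
pose c := invmx M *m (- \col_i t i).
have Mc : M *m c = - \col_i t i by rewrite mulKVmx.
pose s := (a *m c) 0 0 + t0.
(* The left side is the real part of [z k] times exp(i [y k *m c]), a number of argument [s] for
   every [k]. *)
have zs k : complex.Re (z k) * cos ((y k *m c) 0 0)
    - complex.Im (z k) * sin ((y k *m c) 0 0) = cabs (z k) * cos s.
  have zE := has_argM bt0 (has_arg_prod (index_enum _) k wt).
  rewrite /has_arg -/(z k) in zE.
  rewrite [X in complex.Re X]zE [X in complex.Im X]zE /=.
  rewrite -!mulrA -mulrBr -cosD; congr (_ * cos _).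
  rewrite /y mulmxDl -mulmxA Mc mulmxN [X in _ + X = _]mxE.
  rewrite [X in _ + (_ + X) = _]mxE [X in _ + (_ - X) = _]mxE.
  rewrite [X in _ + (_ - X) = _](_ : _ = \sum_i t i *+ k i).
    by rewrite /s; ring.
  by apply: eq_bigr => i _; rewrite !mxE mulr_natl.
have limz (z0 : C) : `|z0| = 1 -> complex.Re z0 = cos s.
  move=> z01; have [F [FF y0 zz0]] := zdense z0 z01.
  have yc : (y k *m c) 0 0 @[k --> F] --> (0 : R).
    have := cvg_lin c 0 F FF; rewrite mul0mx mxE; apply => j.
    by rewrite mxE; exact: y0.
  have ycos : cos ((y k *m c) 0 0) @[k --> F] --> (1 : R).
    by rewrite -(@cos0 R); apply: continuous_cvg yc; exact: continuous_cos.
  have ysin : sin ((y k *m c) 0 0) @[k --> F] --> (0 : R).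
    by rewrite -(@sin0 R); apply: continuous_cvg yc; exact: continuous_sin.
  have lim1 := cvgB (cvgM (cvg_Re zz0) ycos) (cvgM (cvg_Im zz0) ysin).
  have lim2 : cabs (z k) * cos s @[k --> F] --> cabs z0 * cos s.
    by apply: cvgM; [exact: cvg_cabs | exact: cvg_cst].
  have lim1' : cabs (z k) * cos s @[k --> F] -->
      complex.Re z0 * 1 - complex.Im z0 * 0.
    by under eq_fun do rewrite -zs; exact: lim1.
  have := norm_cvg_unique lim1' lim2.
  by rewrite mulr1 mulr0 subr0 /cabs z01 => ->; rewrite mul1r.
have := limz (-1); rewrite -(limz 1) ?normr1 // normrN1 => /(_ erefl) /= /eqP.
by rewrite eq_sym -subr_eq0 opprK -[1 + 1]/(2%:R : R) pnatr_eq0.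
Qed.
End Lattice.

(** * Orbits of commuting matrices *)

Section PolyOrbit.
Variable R : realType.
Local Notation C := (R[i] : numFieldType).

(** A factor vanishing somewhere on [rs] must have exponent 0 in a nonvanishing product. *)
Lemma nonvanishing_expr_prod (rs : seq C) m (P : 'I_m -> {poly C})
    (k : 'I_m -> nat) :
  nonvanishing rs (\prod_i P i ^+ k i) ->
  \prod_i P i ^+ k i =
  \prod_i (if nonvanishing rs (P i) then P i else 1) ^+ k i.
Proof.
move=> Pk; apply: eq_bigr => i _; case: ifPn => // Pi.
move: Pk; rewrite (bigD1 i) //= nonvanishingM => /andP[+ _].
case: (k i) => [|e]; first by rewrite !expr0.
by rewrite exprS nonvanishingM (negPf Pi).
Qed.

Lemma poly_orbit_not_dense n (q g : {poly C}) (P : 'I_n -> {poly C}) :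
  size q = n.+1 -> (0 < n)%N ->
  (forall h, exists2 F : set_system ('I_n -> nat), ProperFilter F &
     forall i, ((g * \prod_j P j ^+ k j) %% q)`_i @[k --> F] --> (h %% q)`_i) ->
  False.
Proof.
move=> size_q n_gt0 dns.
have q0 : q != 0 by rewrite -size_poly_eq0 size_q.
have [r] := @closed_field_poly_normal R[i] q.
rewrite -/(rootprod (r : seq C)); set lc := lead_coef q => qE.
have lc0 : lc != 0 by rewrite lead_coef_eq0.
have [p [p_mon rE p_dvd]] := rootprod_undup (r : seq C).
set rs := undup r in rE; pose d := (size p).-1.
have size_p : size p = d.+1 by rewrite /d prednK // size_poly_gt0 monic_neq0.
(* Degree count: the number of generators equals the dimension of the target of [logvec], so their
   images form a square matrix. *)
have nE : n = (size rs + d)%N.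
  have : size q = n.+1 by [].
  rewrite qE size_scale // rE size_Mmonic ?monic_neq0 ?monic_prod_XsubC //.
  by rewrite /rootprod size_prod_XsubC size_p addSn addnS /= => -[].
have p_rad : p %| rootprod rs ^+ size r.
  by apply: dvdp_trans (rootprod_dvd_exp (r : seq C)); rewrite rE dvdp_mull.
have p_q : p %| q by rewrite qE dvdpZr // rE dvdp_mull.
have p_dq : p %| q^`() by rewrite qE derivZ dvdpZr.
have rs_root : all (root q) rs.
  by apply/allP => z; rewrite mem_undup qE rootZ // root_prod_XsubC.
have rs_uniq : uniq rs by exact: undup_uniq.
move: P dns; rewrite {}nE in n_gt0 size_q *; move=> P dns.
clear - n_gt0 q0 size_p p_rad p_q p_dq rs_root rs_uniq dns.
pose orb k := g * \prod_j P j ^+ k j.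
pose P' j := if nonvanishing rs (P j) then P j else 1.
pose orb' k := g * \prod_j P' j ^+ k j.
have P'_nv j : nonvanishing rs (P' j).
  by rewrite /P'; case: ifP => // _; exact: nonvanishing1.
have near_nv h (F : set_system ('I_(size rs + d) -> nat)) : ProperFilter F ->
    (forall i, ((orb k) %% q)`_i @[k --> F] --> (h %% q)`_i) ->
    nonvanishing rs h -> \forall k \near F, nonvanishing rs (orb k).
  by move=> FF; exact: near_nonvanishing q0 rs_root _ _ _ _ _.
(* The orbit approaches 1, so it contains a unit, and [g] divides that unit. *)
have g_nv : nonvanishing rs g.
  have [F FF cF] := dns 1.
  have [k] := filter_ex (near_nv 1 F FF cF (nonvanishing1 rs)).
  by rewrite nonvanishingM => /andP[].
have dns' h : nonvanishing rs h ->
    exists2 F : set_system ('I_(size rs + d) -> nat), ProperFilter F &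
      forall i, ((orb' k) %% q)`_i @[k --> F] --> (h %% q)`_i.
  move=> hz; have [F FF cF] := dns h; exists F => // i.
  (* Near a unit the orbit consists of units, on which [orb] and [orb'] agree. *)
  apply: cvg_trans (cF i); apply: near_eq_cvg.
  have := near_nv h F FF cF hz; apply: filterS => k.
  rewrite nonvanishingM => /andP[_ Pk].
  by rewrite /orb' /P' -nonvanishing_expr_prod.
have orb'_log k : logvec rs d p (orb' k)
    = logvec rs d p g + (\row_j (k j)%:R) *m (\matrix_j logvec rs d p (P' j)).
  have [Qz Qlog] := logvec_prod size_p p_rad (index_enum _) k P'_nv.
  rewrite (logvecM size_p p_rad) // Qlog mulmx_sum_row; congr (_ + _).
  by apply: eq_bigr => j _; rewrite rowK mxE scaler_nat.
(* Without roots [p] would divide 1, giving [d = 0] against [n_gt0]. *)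
have [z0 z0rs] : exists z0, z0 \in rs.
  case: (rs) n_gt0 p_rad => [|z s] d_gt0 p1; last by exists z; rewrite mem_head.
  move: p1; rewrite /rootprod big_nil expr1n dvdp1 size_p.
  by move: d_gt0; rewrite add0n; case: (d).
have orb'_val k : (orb' k).[z0] = g.[z0] * \prod_j (P' j).[z0] ^+ k j.
  rewrite hornerM horner_prod; congr (_ * _).
  by apply: eq_bigr => j _; rewrite horner_exp.
apply: (@coset_not_dense R _ (\matrix_j logvec rs d p (P' j))
  (logvec rs d p g) g.[z0] (fun j => (P' j).[z0])) => [y|z z1].
  have [h hz <-] := logvec_surj rs_uniq size_p p_rad y.
  have [F FF cF] := dns' h hz; exists F; split => // j.
  under eq_fun do rewrite -orb'_log.
  exact: cvg_logvec size_p p_rad q0 p_q p_dq rs_root _ _ _ _ _ cF _ hz.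
(* Constants of modulus 1 lie in the kernel of [logvec] but take any unimodular value at [z0]. *)
have cz : nonvanishing rs z%:P.
  by apply/allP => x _; rewrite hornerC -normr_gt0 z1.
have logz : logvec rs d p z%:P = 0.
  apply/rowP => j; rewrite [RHS]mxE -(splitK j).
  case: (fintype.split j) => s /=.
    by rewrite row_mxEl mxE hornerC /cabs z1 ln1.
  by rewrite row_mxEr mxE /logder derivC linear0 mul0mx mxE.
have [F FF cF] := dns' _ cz; exists F; split => // [j|].
  under eq_fun do rewrite -orb'_log; have <- : logvec rs d p z%:P 0 j = 0.
    by rewrite logz mxE.
  exact: cvg_logvec size_p p_rad q0 p_q p_dq rs_root _ _ _ _ _ cF _ cz.
under eq_fun do rewrite -orb'_val.
have {1}<- : (z%:P).[z0] = z by rewrite hornerC.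
exact: cvg_horner q0 rs_root _ _ _ _ _ cF _ z0rs.
Qed.
End PolyOrbit.

(** * Commutant and coordinates of a cyclic matrix *)

Section Cyclic.
Variables (K : numFieldType) (n : nat).
Variables (A : 'M[K]_n.+1) (v : 'cV[K]_n.+1).
Hypothesis A_cyclic : forall w : 'cV[K]_n.+1, exists f, w = horner_mx A f *m v.

(** [B] and [horner_mx A f] agree on [v] and commute with [A], so they agree on every
    [horner_mx A h *m v], that is, everywhere. *)
Lemma cyclic_commuting B : B *m A = A *m B -> exists f, B = horner_mx A f.
Proof.
move=> BA; have [f Bv] := A_cyclic (B *m v); exists f.
have eqB (w : 'cV_n.+1) : B *m w = horner_mx A f *m w.
  have [h ->] := A_cyclic w; rewrite !mulmxA.
  have -> : B *m horner_mx A h = horner_mx A h *m B by exact: comm_mx_horner.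
  rewrite -[LHS]mulmxA Bv [LHS]mulmxA; congr (_ *m _).
  by rewrite !mulmxE -!rmorphM mulrC.
apply/matrixP => i j; have /matrixP/(_ i 0) := eqB (delta_mx j 0).
by rewrite -!colE !mxE.
Qed.

(** Turns convergence of vectors into convergence of the coefficients of remainders. *)
Lemma cyclic_coords : exists L : 'M[K]_n.+1, forall f (i : 'I_n.+1),
  (f %% char_poly A)`_i = (L *m (horner_mx A f *m v)) i 0.
Proof.
(* The Krylov matrix, with columns [A ^+ j *m v]; cyclicity gives it a right inverse, and [L] is its
   inverse. *)
pose M : 'M[K]_n.+1 := \matrix_(i, j) (A ^+ j *m v) i 0.
have size_q := size_char_poly A.
have qf0 : char_poly A != 0 by rewrite -size_poly_eq0 size_q.
have coefM f : M *m \col_j (f %% char_poly A)`_j = horner_mx A f *m v.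
  rewrite [in RHS](divp_eq f (char_poly A)) rmorphD rmorphM /= Cayley_Hamilton.
  rewrite mulr0 add0r.
  have size_le : (size (char_poly A) <= n.+2)%N by rewrite size_q.
  rewrite [in RHS](modp_sumXn f qf0 size_le).
  rewrite linear_sum mulmx_suml /=; apply/colP => i; rewrite mxE summxE.
  apply: eq_bigr => j _; rewrite [X in _ * X]mxE [X in X * _]mxE.
  rewrite linearZ /= rmorphXn /= horner_mx_X.
  by rewrite -scalemxAl [in RHS]mxE mulrC.
have [X MX] : exists X, M *m X = 1%:M.
  have /choice[X XE] i := A_cyclic (delta_mx i 0).
  exists (\matrix_(j, i) (X i %% char_poly A)`_j).
  apply/matrixP => i j; have /colP/(_ i) := coefM (X j); rewrite -XE.
  rewrite !mxE eqxx andbT => <-.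
  by apply: eq_bigr => l _; rewrite !mxE.
have [Mu _] := mulmx1_unit MX.
by exists (invmx M) => f i; rewrite -coefM mulKmx // mxE.
Qed.
End Cyclic.

Lemma cyclic_mxP (K : numFieldType) n (A : 'M[K]_n.+1) : cyclic_mx A ->
  exists v : 'cV[K]_n.+1, forall w : 'cV_n.+1, exists f, w = horner_mx A f *m v.
Proof.
case=> v Av; exists v => w; have [N [c ->]] := Av w.
exists (\sum_(k < N) c k *: 'X^k); rewrite linear_sum mulmx_suml /=.
by apply: eq_bigr => k _; rewrite linearZ /= rmorphXn /= horner_mx_X -scalemxAl.
Qed.

(** By density the preimages of the neighbourhoods of [w] are nonempty, so they generate a proper
    filter on exponents along which limits can be taken. *)
Lemma hypercyclic_filter (K : numFieldType) m n (B : 'I_m -> 'M[K]_n) :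
  hypercyclic B -> exists x : 'cV[K]_n, forall w : 'cV[K]_n,
    exists2 F : set_system ('I_m -> nat), ProperFilter F &
      ((\prod_(i < m) B i ^+ k i) *m x) @[k --> F] --> w.
Proof.
case=> x dns; exists x => w.
pose orb (k : 'I_m -> nat) := (\prod_(i < m) B i ^+ k i) *m x.
exists (filter_from (nbhs w) (fun V => orb @^-1` V)).
  apply: filter_from_proper.
    apply: filter_from_filter; first by exists setT; exact: filterT.
    by move=> U V wU wV; exists (U `&` V) => //; exact: filterI.
  move=> V wV; have [|y [Vy [k _ ky]]] := dns V^° _ (@open_interior _ V).
    by exists w.
  by exists k; apply: interior_subset; rewrite /orb ky.
by move=> V wV; exists V.
Qed.

Lemma cvg_mulmx_coord (K : numFieldType) (J : Type) (F : set_system J)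
    {FF : Filter F} m n (L : 'M[K]_(m, n))
    (W : J -> 'cV[K]_n) (w : 'cV[K]_n) i :
  W x @[x --> F] --> w -> (L *m W x) i 0 @[x --> F] --> (L *m w) i 0.
Proof.
move=> Ww; rewrite mxE; under eq_fun do rewrite mxE.
apply: cvg_bigsum => l; apply: cvgM; first exact: cvg_cst.
apply: (@continuous_cvg _ _ _ _ _ W (fun M : 'cV[K]_n => M l 0) w) => //.
exact: coord_continuous.
Qed.

Theorem theorem2p3 (R : realType) (n : nat) (n_ge1 : (1 <= n)%N)
    (B : 'I_n -> 'M[R[i]]_n)
    (B_comm : forall i j : 'I_n, B i *m B j = B j *m B i)
    (B_cyclic : exists j : 'I_n, cyclic_mx (B j)) :
  ~ hypercyclic B.
Proof.
case: n n_ge1 B B_comm B_cyclic => // n _ B B_comm [j /cyclic_mxP[v Av]].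
move=> /hypercyclic_filter[x dns].
have /choice[P BP] i : exists f, B i = horner_mx (B j) f.
  by apply: cyclic_commuting Av _ _; exact: B_comm.
have [g xg] := Av x; have [L LE] := cyclic_coords Av.
apply: (@poly_orbit_not_dense R n.+1 (char_poly (B j)) g P) => //.
  exact: size_char_poly.
move=> h; have [F FF Fw] := dns (horner_mx (B j) h *m v); exists F => // i.
have qf0 : char_poly (B j) != 0 by rewrite -size_poly_eq0 size_char_poly.
(* Coefficients of index above [n] vanish in every remainder; the others are read off by [L]. *)
have [lt_i_n|le_n_i] := ltnP i n.+1; last first.
  have small f : (f %% char_poly (B j))`_i = 0.
    rewrite nth_default // (leq_trans _ le_n_i) //.
    by rewrite -ltnS -(size_char_poly (B j)) ltn_modp.
  by rewrite small; under eq_fun do rewrite small; exact: cvg_cst.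
have orbE (k : 'I_n.+1 -> nat) :
    horner_mx (B j) (g * \prod_l P l ^+ k l) *m v = (\prod_l B l ^+ k l) *m x.
  rewrite mulrC rmorphM /= rmorph_prod xg mulmxA; congr (_ *m _ *m _).
  by apply: eq_bigr => l _; rewrite rmorphXn /= -BP.
rewrite (LE h (Ordinal lt_i_n)).
under eq_fun do rewrite (LE _ (Ordinal lt_i_n)) orbE.
exact: cvg_mulmx_coord Fw.
Qed.
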